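(* Let $w_1,\dots,w_J$ be graphons such that $1,w_1,\dots,w_J$ are linearly independent in $L_2([0,1]^2)$, with span $\mathcal H$ and convex hull $\mathcal C$ as defined in the context. (i) Let $w^\star$ be any graphon, with projection $w^\circ$ onto $\mathcal H$. For every realization of the data, $$\|\hat w_{\mathcal C}-w^\star\|^2\ge \operatorname{dist}^2(w^\star,\mathcal C)\ge\|w^\star-w^\circ\|^2,\qquad \|\hat w_{\mathrm{sel}}-w^\star\|^2\ge\min_j\|w_j-w^\star\|^2\ge\operatorname{dist}^2(w^\star,\mathcal C),$$ and $\operatorname{dist}^2(w^\star,\mathcal C)=\|w^\star-w^\circ\|^2$ if and only if $w^\circ\in\mathcal C$. These floors hold for every sample size. (ii) Suppose the superposition model holds: $w_j=\rho\tilde w_j$ with $0\le\tilde w_j\le1$, $\rho\in(0,1]$, and $w^\star=1-\prod_{j=1}^J(1-w_j)$. Let $e_2=\sum_{j<k}\tilde w_j\tilde w_k$, $a=\sum_{j<k}\min(\|\tilde w_j\|,\|\tilde w_k\|)$, $b=\min_j\|\tilde w_j\|$ and $c_J=2^J-1-J-J(J-1)/2$. Then $$\big|\,\|w^\star-w^\circ\|-\rho^2\operatorname{dist}(e_2,\mathcal H)\,\big|\le c_J\rho^3,\qquad \|w^\star-w^\circ\|\le\rho^2a,$$ $$\rho\Big[\tfrac{J-1}{\sqrt J}\,b-\rho a\Big]_+\le\operatorname{dist}(w^\star,\mathcal C)\le\rho\Big[\sum_{j\ge2}\|\tilde w_j\|+\rho a\Big].$$ (iii) Consequently, in the superposition model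 with fixed templates $\tilde w_1,\dots,\tilde w_J$: if $e_2\notin\mathcal H$, then, as $\rho\to0$, $$\|w^\star-w^\circ\|^2=\rho^4\operatorname{dist}^2(e_2,\mathcal H)\{1+O(\rho)\},$$ and for $J=2$ the identity $\|w^\star-w^\circ\|^2=\rho^4\operatorname{dist}^2(\tilde w_1\tilde w_2,\mathcal H)$ is exact for every $\rho\in(0,1]$; if $b>0$ and $\rho\le (J-1)b/(2\sqrt J\,a)$, then $\operatorname{dist}^2(w^\star,\mathcal C)\ge\rho^2(J-1)^2b^2/(4J)$. Hence (when $e_2\notin\mathcal H$ and $b>0$) the two floors $\|w^\star-w^\circ\|^2$ and $\operatorname{dist}^2(w^\star,\mathcal C)$ are of exact orders $\rho^4$ and $\rho^2$ respectively as $\rho\to0$.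
   Context: A graphon is a measurable symmetric function $w:[0,1]^2\to[0,1]$. $\|\cdot\|$ is the norm of $L_2([0,1]^2)$ (Lebesgue measure) and $\operatorname{dist}(w,\mathcal S)=\inf_{h\in\mathcal S}\|w-h\|$; $[x]_+=\max(x,0)$. The agents are graphons $w_1,\dots,w_J$. The span is $\mathcal H=\{\beta_0+\sum_j\beta_jw_j:\beta\in\mathbb R^{J+1}\}$ (in the superposition model it equals $\mathrm{span}(1,\tilde w_1,\dots,\tilde w_J)$ and does not depend on $\rho$), and the hull is $\mathcal C=\{\sum_j\pi_jw_j:\pi\in\Delta_J\}$, where $\Delta_J$ is the probability simplex in $\mathbb R^J$. For a graphon $w^\star$, $w^\circ$ denotes its orthogonal projection onto $\mathcal H$ in $L_2([0,1]^2)$. The data consist of dyads with positions in $[0,1]^2$ and binary outcomes. The empirical Brier score of a function $w$ is the average over the observed dyads $(U_s,V_s,Y_s)$ of $(Y_s-w(U_s,V_s))^2$. Hull synthesis is $\hat w_{\mathcal C}=\sum_j\hat\pi_jw_j$ with $\hat\pi$ minimizing the empirical Brier score over $\Delta_J$; selection $\hat w_{\mathrm{sel}}$ is the single agent $w_j$ with the smallest empirical Brier score. *)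

(* Defs.v *)
From HB Require Import structures.
From mathcomp Require Export all_boot all_order all_algebra.
From mathcomp Require Export all_classical all_reals all_analysis measurable_realfun.

Set Implicit Arguments.
Unset Strict Implicit.
Unset Printing Implicit Defensive.

Export Order.TTheory GRing.Theory Num.Theory.
Export numFieldNormedType.Exports.

Local Open Scope classical_set_scope.
Local Open Scope ring_scope.

Notation plane R := (measurableTypeR R * measurableTypeR R)%type.

Definition unit_square (R : realType) : set (plane R) := `[0, 1] `*` `[0, 1].

Definition leb2 (R : realType) : {measure set (plane R) -> \bar R} :=
  (@lebesgue_measure R \x @lebesgue_measure R)%E.

(* Elements of L_2([0,1]^2) are represented by total functions plane R -> R whose
   values off the unit square are irrelevant: the norm, the inner product and
   equality of classes below only see the unit square. *)

Definition graphon (R : realType) (w : plane R -> R) : Prop :=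
  [/\ measurable_fun (@unit_square R) w,
      forall x y, @unit_square R (x, y) -> w (x, y) = w (y, x) &
      forall z, @unit_square R z -> 0 <= w z <= 1].

Definition L2norm (R : realType) (f : plane R -> R) : R :=
  fine ('N[leb2 R]_2%:E [EFin \o (f \_ @unit_square R)])%E.

Definition L2dot (R : realType) (f g : plane R -> R) : R :=
  \int[leb2 R]_(z in @unit_square R) (f z * g z).

Definition L2eq (R : realType) (f g : plane R -> R) : Prop :=
  ae_eq (leb2 R) (@unit_square R) f g.

(* f belongs to S as a class modulo a.e. equality. *)
Definition L2mem (R : realType) (f : plane R -> R) (S : set (plane R -> R)) : Prop :=
  exists2 h, S h & L2eq f h.

Definition L2dist (R : realType) (f : plane R -> R) (S : set (plane R -> R)) : R :=
  inf [set L2norm (f \- h) | h in S].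

Definition lincomb (R : realType) (J : nat) (w : 'I_J -> plane R -> R)
    (beta : 'I_J -> R) : plane R -> R :=
  fun z => \sum_(j < J) beta j * w j z.

Definition affcomb (R : realType) (J : nat) (w : 'I_J -> plane R -> R)
    (beta0 : R) (beta : 'I_J -> R) : plane R -> R :=
  fun z => beta0 + lincomb w beta z.

Definition simplex (R : realType) (J : nat) : set ('I_J -> R) :=
  [set p | (forall j, 0 <= p j) /\ \sum_(j < J) p j = 1].

Definition agent_span (R : realType) (J : nat) (w : 'I_J -> plane R -> R) :
    set (plane R -> R) :=
  [set h | exists beta0 beta, h = affcomb w beta0 beta].

Definition agent_hull (R : realType) (J : nat) (w : 'I_J -> plane R -> R) :
    set (plane R -> R) :=
  [set lincomb w p | p in @simplex R J].

Definition lin_indep1 (R : realType) (J : nat) (w : 'I_J -> plane R -> R) : Prop :=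
  forall beta0 beta, L2eq (affcomb w beta0 beta) (cst 0) ->
    beta0 = 0 /\ forall j, beta j = 0.

Definition agents (R : realType) (J : nat) (w : 'I_J -> plane R -> R) : Prop :=
  (forall j, graphon (w j)) /\ lin_indep1 w.

Definition is_orth_proj (R : realType) (S : set (plane R -> R))
    (f p : plane R -> R) : Prop :=
  S p /\ forall h, S h -> L2dot (f \- p) h = 0.

(* The default value of xget is used only if f has no projection onto S; for
   S = agent_span w a projection always exists. *)
Definition orth_proj (R : realType) (S : set (plane R -> R))
    (f : plane R -> R) : plane R -> R :=
  xget (cst 0) [set p | is_orth_proj S f p].

(* The dyad (U, V, Y) is ((U, V), Y). *)
Definition dyad (R : realType) : Type := (plane R * bool)%type.

Definition brier (R : realType) (n : nat) (data : n.-tuple (dyad R))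
    (w : plane R -> R) : R :=
  (\sum_(s < n) ((tnth data s).2%:R - w (tnth data s).1) ^+ 2) / n%:R.

(* Minimizers need not be unique, hence predicates rather than functions. *)
Definition hull_weights (R : realType) (J n : nat) (data : n.-tuple (dyad R))
    (w : 'I_J -> plane R -> R) (p : 'I_J -> R) : Prop :=
  simplex p /\
  forall q, simplex q -> brier data (lincomb w p) <= brier data (lincomb w q).

Definition selected (R : realType) (J n : nat) (data : n.-tuple (dyad R))
    (w : 'I_J -> plane R -> R) (j : 'I_J) : Prop :=
  forall k, brier data (w j) <= brier data (w k).

Definition min_agents (R : realType) (J : nat) (hJ : (0 < J)%N)
    (F : 'I_J -> R) : R :=
  \big[Num.min/F (Ordinal hJ)]_(j < J) F j.

Definition superposition (R : realType) (J : nat)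
    (w : 'I_J -> plane R -> R) : plane R -> R :=
  fun z => 1 - \prod_(j < J) (1 - w j z).

Definition scale_agents (R : realType) (J : nat) (rho : R)
    (wt : 'I_J -> plane R -> R) : 'I_J -> plane R -> R :=
  fun j z => rho * wt j z.

Definition pair_sum (R : realType) (J : nat) (wt : 'I_J -> plane R -> R) :
    plane R -> R :=
  fun z => \sum_(j < J) \sum_(k < J | (j < k)%N) wt j z * wt k z.

Definition pair_min_norm (R : realType) (J : nat) (wt : 'I_J -> plane R -> R) : R :=
  \sum_(j < J) \sum_(k < J | (j < k)%N) Num.min (L2norm (wt j)) (L2norm (wt k)).

(* The number of subsets of {1, ..., J} with at least three elements. *)
Definition tail_const (R : realType) (J : nat) : R :=
  2 ^+ J - 1 - J%:R - J%:R * (J%:R - 1) / 2.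

(* Main.v *)
Require Import Defs.
From mathcomp Require Import ring lra.

Set Implicit Arguments.
Unset Strict Implicit.
Unset Printing Implicit Defensive.

Local Open Scope classical_set_scope.
Local Open Scope ring_scope.

(** Selection and hull synthesis output points of the hull, and the hull lies in
    the span; this gives the chain of floors of (i). Equality of the two floors
    is decided by Pythagoras (L2norm_sqr_proj): the squared distance from w* to a
    point h of the hull exceeds that to its projection wo by |wo - h|^2, and a
    nearest h exists because the simplex is compact (L2dist_hull_attained).

    For the superposition model, expand
    w* = 1 - prod_j (1 - w_j) = s - rho^2 e2 + O(rho^3),
    where s = sum_j w_j lies in the span. Pointwise, the Bonferroni inequality
    (bonferroni) gives 0 <= s - w* <= rho^2 e2, and the remainder after the pair
    sum is at most c_J rho^3 (third_order), c_J counting the subsets with at least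
    three elements. Distances to the span do not see s and scale under
    multiplication (span_distZD), and distances are 1-Lipschitz (L2dist_lip);
    hence |w* - wo| = rho^2 dist(e2, H) + O(rho^3), without error when J = 2. The
    hull, by contrast, misses a first-order part: s - sum_j p_j w_j is
    rho sum_j (1 - p_j) wt_j, where the weights 1 - p_j >= 0 sum to J - 1 and the
    templates are nonnegative, so that its norm is at least
    rho (J - 1) b / sqrt J (lincomb_compl_lower). As |s - w*| <= rho^2 a, the
    distance to the hull is of order rho.

    The asymptotic statements follow by squaring, since dist(e2, H) > 0 when e2 is
    not in H as a class, and J > 1 in that case because the pair sum of a single
    agent is 0.

    Integration enters only through an inner product on the functions that are
    bounded and measurable on the square. Orthogonal projections onto the span
    are built by Gram-Schmidt (proj_adjoin). *)

(** * Bounded measurable functions on the unit square *)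

Section square.
Context {R : realType}.
Local Notation sq := (@unit_square R).
Implicit Types f g h : plane R -> R.

Lemma measurable_sq : measurable sq.
Proof. by apply: measurableX; exact: measurable_itv. Qed.

Lemma leb2_sq : leb2 R sq = 1%E.
Proof.
have I01 : @lebesgue_measure R `[0, 1]%classic = 1%E.
  by rewrite lebesgue_measure_itv /= lte_fin ltr01 oppr0 adde0.
rewrite /leb2 /unit_square [LHS]product_measure1E; try exact: measurable_itv.
by rewrite [X in (X * _)%E]I01 [X in (_ * X)%E]I01 mule1.
Qed.

(** Every function of the problem lies in this algebra. Its products are
    integrable and its norms finite, so that L2dot is bilinear on it, which
    fails for total functions without integrability. *)
Definition bounded_mfun f : Prop :=
  measurable_fun sq f /\ exists M, forall z, sq z -> `|f z| <= M.

Lemma bmf_cst (c : R) : bounded_mfun (fun=> c).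
Proof. by split; [exact: measurable_cst | exists `|c|]. Qed.

Lemma bmfD f g : bounded_mfun f -> bounded_mfun g -> bounded_mfun (f \+ g).
Proof.
move=> [mf [M fM]] [mg [N gN]]; split; first exact: measurable_funD.
by exists (M + N) => z qz; rewrite (le_trans (ler_normD _ _))// lerD ?fM ?gN.
Qed.

Lemma bmfM f g : bounded_mfun f -> bounded_mfun g -> bounded_mfun (f \* g).
Proof.
move=> [mf [M fM]] [mg [N gN]]; split; first exact: measurable_funM.
by exists (M * N) => z qz; rewrite normrM ler_pM ?fM ?gN.
Qed.

Lemma bmfZ (c : R) f : bounded_mfun f -> bounded_mfun (fun z => c * f z).
Proof. by move=> bf; apply: bmfM bf; exact: bmf_cst. Qed.

Lemma bmfN f : bounded_mfun f -> bounded_mfun (\- f).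
Proof.
move=> bf; rewrite (_ : \- f = fun z => -1 * f z); first exact: bmfZ.
by apply/funext => z /=; rewrite mulN1r.
Qed.

Lemma bmfB f g : bounded_mfun f -> bounded_mfun g -> bounded_mfun (f \- g).
Proof. by move=> bf bg; apply: bmfD => //; exact: bmfN. Qed.

(** One closure rule for the sums and the products occurring in the mixtures,
    the pair sum and the superposition. *)
Lemma bmf_bigop (op : R -> R -> R) (idx : R) :
  (forall f g, bounded_mfun f -> bounded_mfun g ->
     bounded_mfun (fun z => op (f z) (g z))) ->
  forall (I : Type) (r : seq I) (P : pred I) (F : I -> plane R -> R),
  (forall i, P i -> bounded_mfun (F i)) ->
  bounded_mfun (fun z => \big[op/idx]_(i <- r | P i) F i z).
Proof.
move=> bop I r P F bF; elim: r => [|i r IHr].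
  rewrite (_ : (fun z => _) = fun=> idx); first exact: bmf_cst.
  by apply/funext => z; rewrite big_nil.
have [Pi|NPi] := boolP (P i); last first.
  rewrite (_ : (fun z => _) = fun z => \big[op/idx]_(j <- r | P j) F j z) //.
  by apply/funext => z; rewrite big_cons (negbTE NPi).
rewrite (_ : (fun z => _) =
    fun z => op (F i z) (\big[op/idx]_(j <- r | P j) F j z)).
  by apply: bop => //; exact: bF.
by apply/funext => z; rewrite big_cons Pi.
Qed.

Lemma bmf_eq f g : {in sq, f =1 g} -> bounded_mfun f -> bounded_mfun g.
Proof.
move=> fg [mf [M fM]]; split; first exact: eq_measurable_fun mf.
by exists M => z qz; rewrite -fg ?fM ?inE.
Qed.

Lemma graphon_bmf w : graphon w -> bounded_mfun w.
Proof.
move=> [mw _ w01]; split=> //; exists 1 => z /w01 /andP[w0 w1].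
by rewrite ger0_norm.
Qed.

Lemma bmf_integrable f : bounded_mfun f -> (leb2 R).-integrable sq (EFin \o f).
Proof.
move=> [mf [M fM]]; apply: measurable_bounded_integrable => //.
- exact: measurable_sq.
- by rewrite leb2_sq ltry.
- exists M; split; first exact: num_real.
  by move=> N MN z qz /=; rewrite (le_trans (fM _ qz))// ltW.
Qed.

Lemma L2dotC f g : L2dot f g = L2dot g f.
Proof. by apply: eq_Rintegral => z _; rewrite mulrC. Qed.

Lemma L2dotDl f g h : bounded_mfun f -> bounded_mfun g -> bounded_mfun h ->
  L2dot (f \+ g) h = L2dot f h + L2dot g h.
Proof.
move=> bf bg bh; rewrite /L2dot -RintegralD; first last.
- by apply: bmf_integrable; exact: bmfM.
- by apply: bmf_integrable; exact: bmfM.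
- exact: measurable_sq.
by apply: eq_Rintegral => z _ /=; rewrite mulrDl.
Qed.

Lemma L2dotZl (c : R) f h : bounded_mfun f -> bounded_mfun h ->
  L2dot (fun z => c * f z) h = c * L2dot f h.
Proof.
move=> bf bh; rewrite /L2dot -RintegralZl; first last.
- by apply: bmf_integrable; exact: bmfM.
- exact: measurable_sq.
by apply: eq_Rintegral => z _ /=; rewrite mulrA.
Qed.

Lemma L2dot_ge0 f g : (forall z, sq z -> 0 <= f z * g z) -> 0 <= L2dot f g.
Proof. exact: Rintegral_ge0. Qed.

Lemma L2dot11 : L2dot (cst 1) (cst 1) = 1 :> R.
Proof.
transitivity (\int[leb2 R]_(z in sq) (1 : R)).
  by apply: eq_Rintegral => z _; exact: mulr1.
by rewrite (Rintegral_cst (leb2 R) measurable_sq) leb2_sq mul1r.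
Qed.

Lemma L2norm_ge0 f : 0 <= L2norm f.
Proof. by apply: fine_ge0; exact: Lnorm_ge0. Qed.

(** The pth root in the definition of the norm is undone by poweR_Lnorm; on
    infinite values both sides are 0 because fine is. From here on the norm is
    handled through the inner product alone. *)
Lemma L2norm_sqr f : L2norm f ^+ 2 = L2dot f f.
Proof.
have E : (\int[leb2 R]_x `| (EFin \o f \_ sq) x | `^ 2 =
          \int[leb2 R]_(z in sq) (f z * f z)%:E)%E.
  rewrite [RHS]integral_mkcond; apply: eq_integral => z _.
  rewrite /= !patchE; case: ifPn => _; last by rewrite normr0 powR0.
  by rewrite powR_mulrn // real_normK ?num_real // expr2.
have n2 : (2 : R) != 0 by exact: lt0r_neq0.
have NE := poweR_Lnorm (leb2 R) (EFin \o f \_ sq) n2.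
by rewrite /L2dot /Rintegral -E -NE fine_poweR powR_mulrn // L2norm_ge0.
Qed.

Lemma L2norm0_eq f g : bounded_mfun f -> bounded_mfun g ->
  L2norm (f \- g) = 0 -> L2eq f g.
Proof.
move=> bf bg n0; have [mdd _] := bmfM (bmfB bf bg) (bmfB bf bg).
have I0 : (\int[leb2 R]_(z in sq) `|((f z - g z) * (f z - g z))%:E| = 0)%E.
  rewrite -[LHS]fineK; last first.
    rewrite ge0_fin_numE ?integral_ge0 //.
    have /integrableP[_] := bmf_integrable (bmfM (bmfB bf bg) (bmfB bf bg)).
    exact.
  have := L2norm_sqr (f \- g); rewrite n0 expr0n => /= d0.
  suff -> : fine (\int[leb2 R]_(z in sq) `|((f z - g z) * (f z - g z))%:E|)%E
            = L2dot (f \- g) (f \- g) by rewrite -d0.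
  rewrite /L2dot /Rintegral; congr fine; apply: eq_integral => z _ /=.
  by rewrite ger0_norm // -expr2 sqr_ge0.
have mE : measurable_fun sq (EFin \o ((f \- g) \* (f \- g))).
  exact/measurable_EFinP.
have := (ae_eq_integral_abs (leb2 R) measurable_sq mE).1 I0.
apply: filterS => z /= /[apply] -[/eqP].
by rewrite mulf_eq0 orbb subr_eq0 => /eqP.
Qed.

Lemma eq_L2norm0 f g : bounded_mfun f -> bounded_mfun g ->
  L2eq f g -> L2norm (f \- g) = 0.
Proof.
move=> bf bg fg; apply/eqP; rewrite -sqrf_eq0 L2norm_sqr; apply/eqP.
have [mdd _] := bmfM (bmfB bf bg) (bmfB bf bg).
rewrite /L2dot /Rintegral (_ : (\int[_]_(_ in _) _)%E = 0%E) //.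
rewrite (@ae_eq_integral _ _ _ _ _ (cst 0%E)) ?integral0 //.
- exact: measurable_sq.
- exact/measurable_EFinP.
- apply: filterS fg => z /= /[apply] ->; by rewrite subrr mulr0.
Qed.

Lemma eq_L2norm f g : {in sq, f =1 g} -> L2norm f = L2norm g.
Proof.
move=> fg; rewrite /L2norm; congr (fine (Lnorm _ _ _)); apply/funext => z /=.
by rewrite !patchE; case: ifPn => // /fg ->.
Qed.

Lemma L2normN f : L2norm (\- f) = L2norm f.
Proof.
apply/eqP; rewrite -(eqrXn2 (ltn0Sn 1)) ?L2norm_ge0 // !L2norm_sqr.
by apply/eqP; apply: eq_Rintegral => z _ /=; rewrite mulrNN.
Qed.

Lemma L2norm_subC f g : L2norm (f \- g) = L2norm (g \- f).
Proof.
by rewrite -L2normN; congr L2norm; apply/funext => z /=; rewrite opprB.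
Qed.

Lemma L2normZ (c : R) f : bounded_mfun f ->
  L2norm (fun z => c * f z) = `|c| * L2norm f.
Proof.
move=> bf; apply/eqP; rewrite -(eqrXn2 (ltn0Sn 1)) ?mulr_ge0 ?L2norm_ge0 //.
rewrite exprMn !L2norm_sqr L2dotZl //; last exact: bmfZ.
by rewrite L2dotC L2dotZl // mulrA -expr2 real_normK ?num_real.
Qed.

Lemma L2norm_sqrD f g : bounded_mfun f -> bounded_mfun g ->
  L2norm (f \+ g) ^+ 2 = L2norm f ^+ 2 + 2 * L2dot f g + L2norm g ^+ 2.
Proof.
move=> bf bg; have bfg := bmfD bf bg.
rewrite !L2norm_sqr L2dotDl // L2dotC L2dotDl // [L2dot g (f \+ g)]L2dotC.
by rewrite L2dotDl // (L2dotC g f); ring.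
Qed.

(** Cauchy-Schwarz in its one-sided form, from the nonnegativity of the
    quadratic form |s f + t g|^2 in (s, t), evaluated at s = |g|, t = -|f|. *)
Lemma L2dot_le f g : bounded_mfun f -> bounded_mfun g ->
  L2dot f g <= L2norm f * L2norm g.
Proof.
move=> bf bg; have [a0 b0] := (L2norm_ge0 f, L2norm_ge0 g).
set a := L2norm f in a0 *; set b := L2norm g in b0 *; set d := L2dot f g.
have key (s t : R) : 0 <= s ^+ 2 * a ^+ 2 + 2 * (s * t) * d + t ^+ 2 * b ^+ 2.
  have := sqr_ge0 (L2norm ((fun z => s * f z) \+ (fun z => t * g z))).
  rewrite L2norm_sqrD; [|exact: bmfZ|exact: bmfZ].
  rewrite !L2normZ // !exprMn !real_normK ?num_real // L2dotZl //; last exact: bmfZ.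
  by rewrite L2dotC L2dotZl // (L2dotC g) /a /b /d; congr (_ <= _); ring.
(* If a norm vanishes, the quadratic form is affine in one variable. *)
have [a00|a_gt0] := eqVneq a 0.
  rewrite a00 mul0r leNgt; apply/negP => d0.
  have := key (- (b ^+ 2 + 1) / (2 * d)) 1; rewrite a00.
  rewrite (_ : _ + _ = -1 :> R) ?ler0N1 //; field; exact: lt0r_neq0.
have [b00|b_gt0] := eqVneq b 0.
  rewrite b00 mulr0 leNgt; apply/negP => d0.
  have := key 1 (- (a ^+ 2 + 1) / (2 * d)); rewrite b00.
  rewrite (_ : _ + _ = -1 :> R) ?ler0N1 //; field; exact: lt0r_neq0.
have ap : 0 < a by rewrite lt_def a_gt0.
have bp : 0 < b by rewrite lt_def b_gt0.
have := key b (- a); have : 0 < a * b by exact: mulr_gt0.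
set ab := a * b => abp h.
have : 0 <= 2 * ab * (ab - d) by apply: le_trans h _; rewrite /ab; lra.
by rewrite pmulr_rge0 ?subr_ge0 // mulr_gt0.
Qed.

Lemma ler_L2normD f g : bounded_mfun f -> bounded_mfun g ->
  L2norm (f \+ g) <= L2norm f + L2norm g.
Proof.
move=> bf bg; rewrite -(ler_pXn2r (ltn0Sn 1)) ?nnegrE ?addr_ge0 ?L2norm_ge0 //.
have := L2dot_le bf bg; rewrite L2norm_sqrD //; lra.
Qed.

Lemma ler_L2norm_dist f g h : bounded_mfun f -> bounded_mfun g ->
  bounded_mfun h -> L2norm (f \- h) <= L2norm (f \- g) + L2norm (g \- h).
Proof.
move=> bf bg bh; rewrite (_ : f \- h = (f \- g) \+ (g \- h)).
  by apply: ler_L2normD; exact: bmfB.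
by apply/funext => z /=; ring.
Qed.

Lemma ler_L2norm f g : bounded_mfun f -> bounded_mfun g ->
  (forall z, sq z -> `|f z| <= g z) -> L2norm f <= L2norm g.
Proof.
move=> bf bg fg; rewrite -(ler_pXn2r (ltn0Sn 1)) ?nnegrE ?L2norm_ge0 //.
rewrite !L2norm_sqr; apply: le_Rintegral.
- exact: measurable_sq.
- by apply: bmf_integrable; exact: bmfM.
- by apply: bmf_integrable; exact: bmfM.
- move=> z /fg fgz; rewrite -!expr2 -[f z ^+ 2]real_normK ?num_real //.
  by rewrite ler_pXn2r // nnegrE // (le_trans _ fgz).
Qed.

Lemma L2norm_cst (c : R) : 0 <= c -> L2norm (cst c : plane R -> R) = c.
Proof.
move=> c0; have -> : cst c = (fun z : plane R => c * cst 1 z).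
  by apply/funext => z; rewrite /= mulr1.
rewrite L2normZ; last exact: bmf_cst.
rewrite ger0_norm // -[RHS]mulr1; congr (c * _); apply/eqP.
by rewrite -(eqrXn2 (ltn0Sn 1)) ?L2norm_ge0 // L2norm_sqr L2dot11 expr1n.
Qed.

Lemma ler_L2norm_sum (I : Type) (r : seq I) (P : pred I) (F : I -> plane R -> R) :
  (forall i, P i -> bounded_mfun (F i)) ->
  L2norm (fun z => \sum_(i <- r | P i) F i z) <= \sum_(i <- r | P i) L2norm (F i).
Proof.
move=> bF; elim: r => [|i r IHr].
  rewrite big_nil (_ : (fun z => _) = cst 0) ?L2norm_cst //.
  by apply/funext => z; rewrite big_nil.
rewrite big_cons; have [Pi|NPi] := boolP (P i); last first.
  rewrite (_ : (fun z => _) = fun z => \sum_(j <- r | P j) F j z) //.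
  by apply/funext => z; rewrite big_cons (negbTE NPi).
rewrite (_ : (fun z => _) = F i \+ fun z => \sum_(j <- r | P j) F j z).
  apply: le_trans (ler_L2normD _ _) _; first exact: bF.
    by apply: bmf_bigop bF; exact: bmfD.
  by rewrite lerD2l.
by apply/funext => z; rewrite big_cons Pi.
Qed.

End square.

(** * Distance and orthogonal projection *)

Section distance.
Context {R : realType}.
Implicit Types (f g h p : plane R -> R) (S : set (plane R -> R)).

Lemma L2dist_lb f S : has_lbound [set L2norm (f \- h) | h in S].
Proof. by exists 0 => _ [h _ <-]; exact: L2norm_ge0. Qed.

Lemma L2dist_le f S h : S h -> L2dist f S <= L2norm (f \- h).
Proof. by move=> Sh; apply: ge_inf; [exact: L2dist_lb | exists h]. Qed.

Lemma le_L2dist f S x : S !=set0 -> (forall h, S h -> x <= L2norm (f \- h)) ->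
  x <= L2dist f S.
Proof.
move=> [h Sh] xS; apply: lb_le_inf; first by exists (L2norm (f \- h)), h.
by move=> _ [g Sg <-]; exact: xS.
Qed.

Lemma L2dist_ge0 f S : S !=set0 -> 0 <= L2dist f S.
Proof. by move=> S0; apply: le_L2dist => // h _; exact: L2norm_ge0. Qed.

Lemma eq_L2dist f g S : {in @unit_square R, f =1 g} -> L2dist f S = L2dist g S.
Proof.
move=> fg; congr inf; apply: eq_imagel => h _.
by apply: eq_L2norm => z qz /=; rewrite fg.
Qed.

(** The distance to a set is 1-Lipschitz; this transfers pointwise expansions
    of the superposition to its distances. *)
Lemma L2dist_lip f g S : S !=set0 -> (forall h, S h -> bounded_mfun h) ->
  bounded_mfun f -> bounded_mfun g ->
  L2dist f S <= L2dist g S + L2norm (f \- g).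
Proof.
move=> S0 bS bf bg; rewrite -lerBlDr; apply: le_L2dist => // h Sh.
rewrite lerBlDr; apply: le_trans (L2dist_le f Sh) _.
by rewrite addrC; apply: ler_L2norm_dist => //; exact: bS.
Qed.

Definition bounded_subspace S : Prop :=
  [/\ S (cst 0), forall h, S h -> bounded_mfun h &
      forall c h g, S h -> S g -> S (fun z => c * h z + g z)].

Lemma subspaceB S h g : bounded_subspace S -> S h -> S g -> S (h \- g).
Proof.
move=> [_ _ lS] Sh Sg; rewrite (_ : h \- g = fun z => -1 * g z + h z).
  exact: lS.
by apply/funext => z /=; ring.
Qed.

(** Pythagoras: p - h lies in S, hence is orthogonal to f - p. *)
Lemma L2norm_sqr_proj S f p h : bounded_subspace S -> bounded_mfun f ->
  is_orth_proj S f p -> S h ->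
  L2norm (f \- h) ^+ 2 = L2norm (f \- p) ^+ 2 + L2norm (p \- h) ^+ 2.
Proof.
move=> subS bf [Sp fp] Sh; have [_ bS _] := subS.
have -> : f \- h = (f \- p) \+ (p \- h) by apply/funext => z /=; ring.
rewrite L2norm_sqrD ?fp ?mulr0 ?addr0 //; first exact: subspaceB.
  by apply: bmfB => //; exact: bS.
by apply: bmfB; exact: bS.
Qed.

Lemma L2dist_proj S f p : bounded_subspace S -> bounded_mfun f ->
  is_orth_proj S f p -> L2dist f S = L2norm (f \- p).
Proof.
move=> subS bf fp; apply/eqP; rewrite eq_le L2dist_le /=; last by case: fp.
apply: le_L2dist => [|h Sh]; first by exists p; case: fp.
rewrite -(ler_pXn2r (ltn0Sn 1)) ?nnegrE ?L2norm_ge0 //.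
by rewrite (L2norm_sqr_proj subS bf fp Sh) lerDl sqr_ge0.
Qed.

(** Projections onto S are equivariant under f |-> c f + h with h in S; hence
    distances to S ignore S-components and scale by |c|. *)
Lemma orth_projZD S f p c h : bounded_subspace S -> bounded_mfun f ->
  is_orth_proj S f p -> S h ->
  is_orth_proj S (fun z => c * f z + h z) (fun z => c * p z + h z).
Proof.
move=> [_ bS lS] bf [Sp fp] Sh; split=> [|g Sg]; first exact: lS.
transitivity (L2dot (fun z => c * (f \- p) z) g).
  by apply: eq_Rintegral => z _ /=; ring.
by rewrite L2dotZl ?fp ?mulr0 //; [apply: bmfB => //|]; exact: bS.
Qed.

Lemma L2dot0r f g : bounded_mfun f -> bounded_mfun g -> L2norm g = 0 ->
  L2dot f g = 0.
Proof.
move=> bf bg g0; have := L2dot_le bf bg.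
have := L2dot_le (bmfN bf) bg; rewrite g0 !mulr0 => h1 h2.
have : L2dot (\- f) g = - L2dot f g; last by lra.
rewrite -[RHS]mulN1r -L2dotZl //.
by apply: eq_Rintegral => z _ /=; ring.
Qed.

(** One step of Gram-Schmidt: replace g by its residual u = g - q, orthogonal
    to S, and add to the projection onto S the component along u. If u vanishes
    almost everywhere its coefficient is irrelevant, so g may be linearly
    dependent on S. *)
Lemma proj_adjoin S g : bounded_subspace S -> bounded_mfun g ->
  (forall f, bounded_mfun f -> exists p, is_orth_proj S f p) ->
  let S' := [set k | exists c h, S h /\ k = fun z => c * g z + h z] in
  forall f, bounded_mfun f -> exists p, is_orth_proj S' f p.
Proof.
move=> [S0 bS lS] bg projS S' f bf.
have [[q [Sq gq]] [p [Sp fp]]] := (projS g bg, projS f bf).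
have [bq bp] := (bS _ Sq, bS _ Sp).
have [bgq bfp] := (bmfB bg bq, bmfB bf bp).
set u := g \- q in gq bgq; pose t := L2dot (f \- p) u / L2norm u ^+ 2.
exists (fun z => t * u z + p z); split=> [|_ [c [h [Sh ->]]]].
  exists t, (fun z => (- t) * q z + p z); split; first exact: lS.
  by apply/funext => z; rewrite /u /=; ring.
pose k z := c * q z + h z.
have Sk : S k by exact: lS.
have bk := bS _ Sk.
have bcu : bounded_mfun (fun z => c * u z) by exact: bmfZ.
have btu : bounded_mfun (fun z => (- t) * u z) by exact: bmfZ.
pose v := f \- p; have bv : bounded_mfun v by [].
have -> : L2dot (f \- (fun z => t * u z + p z)) (fun z => c * g z + h z)
   = L2dot ((fun z => c * u z) \+ k) (v \+ fun z => (- t) * u z).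
  by apply: eq_Rintegral => z _; rewrite /u /k /v /=; ring.
have dotDr a : bounded_mfun a ->
    L2dot a (v \+ fun z => (- t) * u z) = L2dot v a - t * L2dot u a.
  by move=> ba; rewrite L2dotC L2dotDl // L2dotZl // mulNr.
rewrite L2dotDl //; last exact: bmfD.
rewrite !dotDr // [L2dot v k]fp // [L2dot u k]gq // mulr0 subr0 addr0.
rewrite ![L2dot _ (fun z => c * u z)]L2dotC !L2dotZl // (L2dotC u v).
rewrite -L2norm_sqr.
have [u0|u0] := eqVneq (L2norm u) 0.
  by rewrite L2dot0r // u0 expr0n /= !mulr0 subrr.
by rewrite mulrCA /t divfK ?subrr // sqrf_eq0.
Qed.

End distance.

(** * Span of the agents *)

Section agents.
Context {R : realType}.

Lemma bmf_lincomb J (w : 'I_J -> plane R -> R) b :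
  (forall j, bounded_mfun (w j)) -> bounded_mfun (lincomb w b).
Proof.
move=> bw; apply: (bmf_bigop (op := +%R)) => [|j _]; first exact: bmfD.
exact: bmfZ.
Qed.

Lemma lincombD J (w : 'I_J -> plane R -> R) c b b' z :
  c * lincomb w b z + lincomb w b' z = lincomb w (fun j => c * b j + b' j) z.
Proof.
by rewrite /lincomb mulr_sumr -big_split; apply: eq_bigr => j _ /=; ring.
Qed.

Lemma span_subspace J (w : 'I_J -> plane R -> R) :
  (forall j, bounded_mfun (w j)) -> bounded_subspace (agent_span w).
Proof.
move=> bw; split.
- exists 0, (fun=> 0); apply/funext => z; rewrite /affcomb /lincomb add0r.
  by rewrite big1 // => j _; rewrite mul0r.
- move=> _ [b0 [b ->]]; apply: (@bmfD _ (fun=> b0)); first exact: bmf_cst.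
  exact: bmf_lincomb.
- move=> c _ _ [b0 [b ->]] [a0 [a ->]].
  exists (c * b0 + a0), (fun j => c * b j + a j); apply/funext => z.
  by rewrite /affcomb -lincombD; ring.
Qed.

(** Induction on the number of agents, the base case being the projection onto
    constants, f |-> <f, 1>. *)
Lemma orth_proj_span_ex J (w : 'I_J -> plane R -> R) :
  (forall j, bounded_mfun (w j)) -> forall f, bounded_mfun f ->
  exists p, is_orth_proj (agent_span w) f p.
Proof.
elim: J w => [|J IHJ] w bw f bf.
  exists (affcomb w (L2dot f (cst 1)) (fun=> 0)); split=> [|_ [b0 [b ->]]].
    by exists (L2dot f (cst 1)), (fun=> 0).
  set a := L2dot f (cst 1).
  have b1 : bounded_mfun (cst 1 : plane R -> R) by exact: bmf_cst.
  have ba := bmfZ (- a) b1.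
  transitivity (L2dot (fun z => b0 * cst 1 z) (f \+ (fun z => - a * cst 1 z))).
    apply: eq_Rintegral => z _; rewrite /affcomb /lincomb /= !big_ord0; ring.
  rewrite L2dotZl //; last exact: bmfD.
  by rewrite L2dotC L2dotDl // L2dotZl // L2dot11 -/a mulr1 subrr mulr0.
pose w' := w \o lift ord0.
have bw' j : bounded_mfun (w' j) by exact: bw.
have [p] := proj_adjoin (span_subspace bw') (bw ord0) (IHJ _ bw') bf.
set S' := (X in is_orth_proj X); suff -> : S' = agent_span w by exists p.
apply/seteqP; split=> [_ [c [_ [[b0 [b ->]] ->]]]|_ [b0 [b ->]]].
  exists b0, (fun j => oapp b c (unlift ord0 j)); apply/funext => z.
  rewrite /affcomb /lincomb big_ord_recl unlift_none /=.
  rewrite addrCA; congr (_ + (_ + _)); apply: eq_bigr => j _.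
  by rewrite liftK.
exists (b ord0), (affcomb w' b0 (b \o lift ord0)); split.
  by exists b0, (b \o lift ord0).
by apply/funext => z; rewrite /affcomb /lincomb big_ord_recl /= addrCA.
Qed.

Section span.
Context (J : nat) (w : 'I_J -> plane R -> R).
Hypothesis bw : forall j, bounded_mfun (w j).

Lemma orth_projP f : bounded_mfun f ->
  is_orth_proj (agent_span w) f (orth_proj (agent_span w) f).
Proof.
by move=> bf; apply: (@xgetPex _ (cst 0) [set p | is_orth_proj _ f p]);
  exact: orth_proj_span_ex.
Qed.

(** Identifies the floor |f - fo| with a distance, which can then be bounded
    without reference to the projection. *)
Lemma L2norm_sub_orth_proj f : bounded_mfun f ->
  L2norm (f \- orth_proj (agent_span w) f) = L2dist f (agent_span w).
Proof.
by move=> bf; rewrite (L2dist_proj (span_subspace bw) bf (orth_projP bf)).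
Qed.

Lemma span_nonempty : agent_span w !=set0.
Proof. by exists (affcomb w 0 (fun=> 0)), 0, (fun=> 0). Qed.

Lemma span_distZD c f h : bounded_mfun f -> agent_span w h ->
  L2dist (fun z => c * f z + h z) (agent_span w) = `|c| * L2dist f (agent_span w).
Proof.
move=> bf Sh; have [p fp] := orth_proj_span_ex bw bf.
have sS := span_subspace bw; have [_ bS _] := sS.
have bp : bounded_mfun p by apply: bS; case: fp.
rewrite (L2dist_proj sS bf fp) (L2dist_proj sS _ (orth_projZD c sS bf fp Sh)).
  rewrite -L2normZ; last exact: bmfB.
  by congr L2norm; apply/funext => z /=; ring.
by apply: bmfD; [exact: bmfZ | exact: bS].
Qed.

Lemma span_dist0 f : bounded_mfun f -> L2dist f (agent_span w) = 0 ->
  L2mem f (agent_span w).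
Proof.
move=> bf d0; have [p fp] := orth_proj_span_ex bw bf.
have sS := span_subspace bw; have [_ bS _] := sS.
exists p; first by case: fp.
apply: L2norm0_eq => //; first by apply: bS; case: fp.
by rewrite -(L2dist_proj sS bf fp).
Qed.

End span.
End agents.

(** * Hull of the agents *)

Lemma normr_coord_le {R : realType} n (v : 'rV[R]_n) i : `|v ord0 i| <= `|v|.
Proof.
rewrite [leRHS]/Num.norm /= mx_normrE.
by apply/bigmax_geP; right => /=; exists (ord0, i).
Qed.

Section hull.
Context {R : realType} (J : nat) (w : 'I_J -> plane R -> R).

Lemma lincomb_delta j : lincomb w (fun k => (k == j)%:R) = w j.
Proof.
apply/funext => z; rewrite /lincomb (bigD1 j) //= eqxx mul1r big1 ?addr0 //.
by move=> k /negbTE ->; rewrite mul0r.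
Qed.

Lemma agent_hull_agent j : agent_hull w (w j).
Proof.
exists (fun k => (k == j)%:R); last exact: lincomb_delta.
split=> [k|]; first exact: ler0n.
by rewrite (bigD1 j) //= eqxx big1 ?addr0 // => k /negbTE ->.
Qed.

Lemma hull_sub_span : agent_hull w `<=` agent_span w.
Proof.
by move=> _ [p _ <-]; exists 0, p; apply/funext => z; rewrite /affcomb add0r.
Qed.

Hypothesis bw : forall j, bounded_mfun (w j).

Lemma ler_L2norm_lincomb b :
  L2norm (lincomb w b) <= \sum_(j < J) `|b j| * L2norm (w j).
Proof.
under eq_bigr do rewrite -L2normZ //.
by apply: ler_L2norm_sum => j _; exact: bmfZ.
Qed.

(** The distance to a mixture is Lipschitz in the weights, for the sup norm,
    with constant the sum of the norms of the agents; so it reaches its minimum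
    on the compact simplex. *)
Lemma L2dist_hull_attained f : (0 < J)%N -> bounded_mfun f ->
  exists2 h, agent_hull w h & L2dist f (agent_hull w) = L2norm (f \- h).
Proof.
move=> hJ bf; pose comb (v : 'rV[R]_J) := lincomb w (v ord0).
pose F (v : 'rV[R]_J) := L2norm (f \- comb v).
have bc v : bounded_mfun (comb v) by exact: bmf_lincomb.
pose K := \sum_(j < J) L2norm (w j).
have K0 : 0 <= K by apply: sumr_ge0 => j _; exact: L2norm_ge0.
have F_lip u v : F u <= F v + K * `|v - u|.
  apply: le_trans (ler_L2norm_dist bf (bc v) (bc u)) _; rewrite lerD2l.
  rewrite (_ : comb v \- comb u = lincomb w ((v - u) ord0)).
    apply: le_trans (ler_L2norm_lincomb _) _; rewrite mulrC mulr_sumr.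
    apply: ler_sum => j _; apply: ler_wpM2r; first exact: L2norm_ge0.
    exact: normr_coord_le.
  apply/funext => z /=; rewrite /comb /lincomb -sumrB.
  by apply: eq_bigr => j _; rewrite !mxE mulrBl.
have F_cont : continuous F.
  move=> v; apply/(@cvgrPdist_le _ _ _ (nbhs v)) => e e0.
  have eK : 0 < e / (K + 1) by rewrite divr_gt0 // ltr_wpDl.
  near=> u.
  have uv : `|v - u| <= e / (K + 1).
    by near: u; exact: (@cvgr_dist_le _ _ _ (nbhs v) _ id v (@cvg_id _ _) _ eK).
  have Ke : K * `|v - u| <= e.
    apply: le_trans (ler_wpM2l K0 uv) _.
    by rewrite mulrA ler_pdivrMr ?ltr_wpDl // mulrC ler_pM2l // lerDl.
  have := F_lip u v; have := F_lip v u; rewrite (distrC u v) ler_norml; lra.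
pose A := [set v : 'rV[R]_J | forall j, `[0, 1]%classic (v ord0 j)] `&`
          [set v : 'rV[R]_J | \sum_(j < J) v ord0 j = 1].
have cA : compact A.
  apply: compact_closedI.
    apply: (@rV_compact R J (fun=> `[0, 1]%classic)) => _; exact: segment_compact.
  apply: (@closed_comp _ _ (fun v : 'rV[R]_J => \sum_(j < J) v ord0 j) [set 1]).
    move=> v _; apply: (continuous_big (op := +%R)) v => [|j _].
      exact: add_continuous.
    exact: coord_continuous.
  exact: closed_eq.
have A0 : A !=set0.
  exists (\row_k (k == Ordinal hJ)%:R); split=> [j /=|/=].
    by rewrite mxE in_itv /= ler0n lern1 leq_b1.
  rewrite (bigD1 (Ordinal hJ)) //= mxE eqxx big1 ?addr0 // => k /negbTE kn.
  by rewrite mxE kn.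
have [v vA vmin] := EVT_min_rV A0 cA (continuous_subspaceT F_cont).
have simplexA p : simplex p -> (\row_j p j) \in A.
  move=> [p0 p1]; rewrite inE; split=> [j /=|/=]; rewrite ?mxE; last first.
    by rewrite -p1; apply: eq_bigr => j _; rewrite mxE.
  rewrite in_itv /= p0 -p1 (bigD1 j) //= lerDl; exact: sumr_ge0.
have hv : agent_hull w (comb v).
  exists (v ord0) => //; move: vA; rewrite inE => -[v01 v1]; split=> // j.
  by have := v01 j; rewrite /= in_itv /= => /andP[].
exists (comb v) => //; apply/eqP; rewrite eq_le L2dist_le //=.
apply: le_L2dist => [|_ [p sp <-]]; first by exists (comb v).
have := vmin _ (simplexA p sp); rewrite /F (_ : comb (\row_j p j) = lincomb w p) //.
by apply/funext => z; apply: eq_bigr => j _; rewrite mxE.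
Unshelve. all: by end_near. Qed.

Lemma L2dist_hull_ge_proj f : (0 < J)%N -> bounded_mfun f ->
  L2dist f (agent_span w) <= L2dist f (agent_hull w).
Proof.
move=> hJ bf; apply: le_L2dist => [|h /hull_sub_span]; last exact: L2dist_le.
by exists (w (Ordinal hJ)); exact: agent_hull_agent.
Qed.

(** By Pythagoras the squared distances from f to the points h of the hull
    exceed |f - fo|^2 by |fo - h|^2; the excess vanishes at a nearest point of
    the hull exactly when fo is, as a class, in the hull. *)
Lemma hull_floor_eqP f : (0 < J)%N -> bounded_mfun f ->
  let fo := orth_proj (agent_span w) f in
  L2dist f (agent_hull w) ^+ 2 = L2norm (f \- fo) ^+ 2 <->
  L2mem fo (agent_hull w).
Proof.
move=> hJ bf fo; have sS := span_subspace bw; have [_ bS _] := sS.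
have fP := orth_projP bw bf.
have bfo : bounded_mfun fo by apply: bS; case: fP.
have pyth h (Hh : agent_hull w h) :=
  L2norm_sqr_proj sS bf fP (hull_sub_span Hh).
split=> [|[h Hh foh]].
  have [h Hh ->] := L2dist_hull_attained hJ bf; rewrite pyth // => /eqP.
  rewrite -subr_eq0 addrAC subrr add0r sqrf_eq0 => /eqP n0.
  by exists h => //; apply: L2norm0_eq => //; exact/bS/hull_sub_span.
have bh : bounded_mfun h by exact/bS/hull_sub_span.
have h0 : L2norm (fo \- h) = 0 by exact: eq_L2norm0.
have hn : L2norm (f \- h) = L2norm (f \- fo).
  apply/eqP; rewrite -(eqrXn2 (ltn0Sn 1)) ?L2norm_ge0 // pyth // h0.
  by rewrite expr0n /= addr0.
congr (_ ^+ 2); apply/eqP; rewrite eq_le -{1}hn L2dist_le //=.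
by rewrite L2norm_sub_orth_proj // L2dist_hull_ge_proj.
Qed.

End hull.

Section min_agents.
Context {R : realType} (J : nat) (hJ : (0 < J)%N).

Lemma min_agents_le (F : 'I_J -> R) j : min_agents hJ F <= F j.
Proof. exact: bigmin_le. Qed.

Lemma le_min_agents (F : 'I_J -> R) x :
  (forall j, x <= F j) -> x <= min_agents hJ F.
Proof. by move=> xF; apply: le_bigmin. Qed.

End min_agents.

(** * Expansions of 1 - (1 - x_1) ... (1 - x_J) *)

Section superposition.
Context {R : realType}.

Definition pairs J (G : 'I_J -> 'I_J -> R) : R :=
  \sum_(j < J) \sum_(k < J | (j < k)%N) G j k.

(** Peeling off the first index: the pairs containing it, and the others. All
    expansions below are inductions along this identity. *)
Lemma pairs_recl J (G : 'I_J.+1 -> 'I_J.+1 -> R) :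
  pairs G = \sum_(k < J) G ord0 (lift ord0 k)
            + pairs (fun j k => G (lift ord0 j) (lift ord0 k)).
Proof.
rewrite /pairs big_ord_recl; congr (_ + _).
  by rewrite big_mkcond big_ord_recl /= add0r.
apply: eq_bigr => j _.
by rewrite big_mkcond big_ord_recl /= add0r [RHS]big_mkcond.
Qed.

Lemma prod_compl_itv J (x : 'I_J -> R) : (forall j, 0 <= x j <= 1) ->
  0 <= \prod_(j < J) (1 - x j) <= 1.
Proof.
move=> x01; elim/big_ind : _ => [|a b /andP[a0 a1] /andP[b0 b1]|j _].
- by rewrite ler01 lexx.
- by rewrite mulr_ge0 // mulr_ile1.
- by have := x01 j; lra.
Qed.

(** Let P be the product and e_1 the sum over the other indices. Adding x_0
    raises the middle term by x_0 (1 - P) and the pair sum by x_0 e_1, and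
    0 <= 1 - P <= e_1. *)
Lemma bonferroni J (x : 'I_J -> R) : (forall j, 0 <= x j <= 1) ->
  0 <= \sum_(j < J) x j - (1 - \prod_(j < J) (1 - x j))
    <= pairs (fun j k => x j * x k).
Proof.
elim: J x => [|J IHJ] x x01; first by rewrite /pairs !big_ord0 !subrr lexx.
rewrite pairs_recl !big_ord_recl -mulr_sumr.
have x'01 j : 0 <= x (lift ord0 j) <= 1 by [].
have := IHJ _ x'01; have := prod_compl_itv x'01; have := x01 ord0.
move: (\prod_(j < J) _) (\sum_(j < J) x _) (pairs _) => P e1 e2.
move=> /andP[x0 x1] /andP[P0 P1] /andP[lo up].
have : 0 <= x ord0 * (1 - P) by rewrite mulr_ge0 ?subr_ge0.
have : 0 <= x ord0 * (e1 - (1 - P)) by rewrite mulr_ge0.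
by move=> *; apply/andP; split; lra.
Qed.

Lemma pairsM_le J (x : 'I_J -> R) rho : (forall j, 0 <= x j <= rho) ->
  pairs (fun j k => x j * x k) <= J%:R * (J%:R - 1) / 2 * rho ^+ 2.
Proof.
elim: J x => [|J IHJ] x xr; first by rewrite /pairs big_ord0 !mul0r.
rewrite pairs_recl -mulr_sumr.
have := IHJ _ (fun j => xr (lift ord0 j)).
have e1_le : \sum_(k < J) x (lift ord0 k) <= J%:R * rho.
  apply: le_trans (_ : \sum_(k < J) rho <= _).
    by apply: ler_sum => j _; have /andP[] := xr (lift ord0 j).
  by rewrite sumr_const card_ord mulr_natl.
have e1_0 : 0 <= \sum_(k < J) x (lift ord0 k).
  by apply: sumr_ge0 => j _; have /andP[] := xr (lift ord0 j).
have /andP[x0 x1] := xr ord0.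
have : x ord0 * \sum_(k < J) x (lift ord0 k) <= rho * (J%:R * rho).
  by apply: ler_pM.
move: (\sum_(k < J) _) (pairs _) => e1 e2 *.
rewrite -natr1; lra.
Qed.

(** The subsets with at least three elements of a set with one more element: the
    old ones, the old ones with the new element, and the pairs with the new
    element. *)
Lemma tail_constS J :
  tail_const R J.+1 = tail_const R J + tail_const R J + J%:R * (J%:R - 1) / 2.
Proof. by rewrite /tail_const -natr1 exprS; field. Qed.

Lemma half_pairs_ge0 J : 0 <= J%:R * (J%:R - 1) / 2 :> R.
Proof.
case: J => [|J]; first by rewrite !mul0r.
by rewrite -natr1 addrK divr_ge0 // mulr_ge0 // ler0n.
Qed.

Lemma tail_const_ge0 J : 0 <= tail_const R J.
Proof.
elim: J => [|J IHJ]; first by rewrite /tail_const expr0; lra.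
by have := half_pairs_ge0 J; rewrite tail_constS; lra.
Qed.

(** With P and e_1 as for bonferroni, a new index changes the remainder by x_0 (e_1 - (1 - P)), which the
    Bonferroni inequality places between 0 and rho times the pair sum; this fits
    the recursion of tail_const. *)
Lemma third_order J (x : 'I_J -> R) rho : rho <= 1 ->
  (forall j, 0 <= x j <= rho) ->
  `| 1 - \prod_(j < J) (1 - x j) - \sum_(j < J) x j
     + pairs (fun j k => x j * x k) | <= tail_const R J * rho ^+ 3.
Proof.
move=> r1; elim: J x => [|J IHJ] x xr.
  rewrite /pairs !big_ord0 subrr subr0 addr0 normr0 /tail_const expr0; lra.
rewrite pairs_recl !big_ord_recl -mulr_sumr.
have x'r j : 0 <= x (lift ord0 j) <= rho by [].
have x'01 j : 0 <= x (lift ord0 j) <= 1 by have := x'r j; lra.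
have := IHJ _ x'r; have := bonferroni x'01; have := pairsM_le x'r.
have /andP[x0 x1] := xr ord0.
move: (\prod_(j < J) _) (\sum_(j < J) x _) (pairs _) => P e1 e2.
move=> e2r /andP[lo up] D.
have -> : 1 - (1 - x ord0) * P - (x ord0 + e1) + (x ord0 * e1 + e2)
  = (1 - P - e1 + e2) + x ord0 * (e1 - (1 - P)) by ring.
apply: le_trans (ler_normD _ _) _.
rewrite [X in _ + X]ger0_norm ?mulr_ge0 //.
have : x ord0 * (e1 - (1 - P)) <= rho * (J%:R * (J%:R - 1) / 2 * rho ^+ 2).
  by apply: ler_pM => //; exact: le_trans e2r.
have : 0 <= tail_const R J * rho ^+ 3.
  by rewrite mulr_ge0 ?tail_const_ge0 // exprn_ge0 // (le_trans x0).
rewrite tail_constS; lra.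
Qed.

End superposition.

(** * Norm inequalities for nonnegative functions and for the simplex *)

Section norm_bounds.
Context {R : realType}.

(** Cross terms of nonnegative functions have nonnegative integrals. *)
Lemma L2norm_sqr_sum_ge (I : Type) (r : seq I) (F : I -> plane R -> R) :
  (forall i, bounded_mfun (F i)) ->
  (forall i z, @unit_square R z -> 0 <= F i z) ->
  \sum_(i <- r) L2norm (F i) ^+ 2 <= L2norm (fun z => \sum_(i <- r) F i z) ^+ 2.
Proof.
move=> bF F0; elim: r => [|i r IHr]; first by rewrite big_nil sqr_ge0.
pose G z := \sum_(j <- r) F j z.
have bG : bounded_mfun G by apply: bmf_bigop => //; exact: bmfD.
rewrite big_cons (_ : (fun z => _) = F i \+ G).
  rewrite L2norm_sqrD // -addrA lerD2l (le_trans IHr) // lerDr mulr_ge0 //.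
  by apply: L2dot_ge0 => z qz; rewrite mulr_ge0 ?F0 // sumr_ge0 // => j _; exact: F0.
by apply/funext => z; rewrite big_cons.
Qed.

(** The coordinates 1 - p j sum to J - 1, and a sum of squares with given sum is
    least when the coordinates are equal. *)
Lemma compl_simplex_sqr J (p : 'I_J -> R) : (0 < J)%N -> simplex p ->
  (J%:R - 1) ^+ 2 / J%:R <= \sum_(j < J) (1 - p j) ^+ 2.
Proof.
move=> hJ [_ p1]; have J0 : J%:R != 0 :> R by rewrite pnatr_eq0 -lt0n.
(* (J - 1) / J is the common value of 1 - p j at the barycenter *)
pose m : R := (J%:R - 1) / J%:R.
have : 0 <= \sum_(j < J) (1 - p j - m) ^+ 2.
  by apply: sumr_ge0 => j _; exact: sqr_ge0.
rewrite (eq_bigr (fun j => (1 - p j) ^+ 2 + (2 * m * p j + (m ^+ 2 - 2 * m)))).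
  rewrite big_split /= big_split /= -mulr_sumr p1 sumr_const card_ord.
  rewrite -[X in _ + (_ + X)]mulr_natr.
  rewrite (_ : 2 * m * 1 + (m ^+ 2 - 2 * m) * J%:R = - ((J%:R - 1) ^+ 2 / J%:R)).
    by rewrite subr_ge0.
  by rewrite /m; field.
by move=> j _; ring.
Qed.

Lemma L2norm_mul_le_min (f g : plane R -> R) :
  bounded_mfun f -> bounded_mfun g ->
  (forall z, @unit_square R z -> 0 <= f z <= 1) ->
  (forall z, @unit_square R z -> 0 <= g z <= 1) ->
  L2norm (f \* g) <= Num.min (L2norm f) (L2norm g).
Proof.
move=> bf bg f01 g01; have bfg := bmfM bf bg.
rewrite le_min; apply/andP; split; apply: ler_L2norm => // z qz /=;
  have /andP[f0 f1] := f01 z qz; have /andP[g0 g1] := g01 z qz;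
  rewrite ger0_norm ?mulr_ge0 //; [exact: ler_piMr | exact: ler_piMl].
Qed.

End norm_bounds.

(** * The superposition model *)

Section model.
Context {R : realType} (J : nat) (hJ : (0 < J)%N).
Context (w wt : 'I_J -> plane R -> R) (rho : R).
Local Notation sq := (@unit_square R).
Hypothesis bw : forall j, bounded_mfun (w j).
Hypothesis r01 : 0 < rho <= 1.
Hypothesis wt01 : forall j z, sq z -> 0 <= wt j z <= 1.
Hypothesis wE : forall j z, sq z -> w j z = rho * wt j z.

Let wstar := superposition w.
Let total : plane R -> R := lincomb w (fun=> 1).
Let a := pair_min_norm wt.
Let b := min_agents hJ (fun j => L2norm (wt j)).

Lemma rho_gt0 : 0 < rho. Proof. by case/andP: r01. Qed.
Lemma rho_ge0 : 0 <= rho. Proof. exact/ltW/rho_gt0. Qed.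
Lemma rho_le1 : rho <= 1. Proof. by case/andP: r01. Qed.

Lemma w_itv j z : sq z -> 0 <= w j z <= rho.
Proof.
move=> qz; have /andP[t0 t1] := wt01 j qz.
by rewrite wE // mulr_ge0 ?rho_ge0 //= ler_piMr // rho_ge0.
Qed.

Lemma w_itv01 j z : sq z -> 0 <= w j z <= 1.
Proof. by move=> qz; have := w_itv j qz; have := rho_le1; lra. Qed.

Lemma bmf_wt j : bounded_mfun (wt j).
Proof.
apply: (bmf_eq _ (bmfZ rho^-1 (bw j))) => z; rewrite inE => qz.
by rewrite wE // mulKf // lt0r_neq0 // rho_gt0.
Qed.

Lemma bmf_superposition : bounded_mfun wstar.
Proof.
apply: (@bmfB _ (fun=> 1)); first exact: bmf_cst.
apply: (bmf_bigop (op := *%R)) => [|j _]; first exact: bmfM.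
by apply: (@bmfB _ (fun=> 1)) => //; exact: bmf_cst.
Qed.

Lemma bmf_pair_sum : bounded_mfun (pair_sum wt).
Proof.
apply: (bmf_bigop (op := +%R)) => [|j _]; first exact: bmfD.
apply: (bmf_bigop (op := +%R)) => [|k _]; first exact: bmfD.
by apply: bmfM; exact: bmf_wt.
Qed.

Lemma bmf_total : bounded_mfun total.
Proof. exact: bmf_lincomb. Qed.

Lemma total_span : agent_span w total.
Proof. by exists 0, (fun=> 1); apply/funext => z; rewrite /affcomb add0r. Qed.

Lemma totalE z : total z = \sum_(j < J) w j z.
Proof. by apply: eq_bigr => j _; rewrite mul1r. Qed.

Lemma pairsM_scale z : sq z ->
  pairs (fun j k => w j z * w k z) = rho ^+ 2 * pair_sum wt z.
Proof.
move=> qz; rewrite /pairs /pair_sum mulr_sumr; apply: eq_bigr => j _.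
by rewrite mulr_sumr; apply: eq_bigr => k _; rewrite !wE //; ring.
Qed.

Lemma L2norm_pair_sum : L2norm (pair_sum wt) <= a.
Proof.
apply: le_trans (ler_L2norm_sum _ _) _ => [j _|].
  apply: (bmf_bigop (op := +%R)) => [|k _]; first exact: bmfD.
  by apply: bmfM; exact: bmf_wt.
apply: ler_sum => j _; apply: le_trans (ler_L2norm_sum _ _) _ => [k _|].
  by apply: bmfM; exact: bmf_wt.
apply: ler_sum => k _.
by apply: L2norm_mul_le_min; [exact: bmf_wt|exact: bmf_wt|exact: wt01|exact: wt01].
Qed.

(** The sum of the agents lies in the span and approximates the superposition to
    second order: hence the upper bound on its distance to the span and both
    bounds on its distance to the hull. *)
Lemma L2norm_superposition_total : L2norm (wstar \- total) <= rho ^+ 2 * a.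
Proof.
apply: le_trans (ler_L2norm _ (bmfZ (rho ^+ 2) bmf_pair_sum) _) _.
- by apply: bmfB; [exact: bmf_superposition | exact: bmf_total].
- move=> z qz /=; have /andP[lo up] := bonferroni (fun j => w_itv01 j qz).
  by rewrite -pairsM_scale // distrC totalE ger0_norm.
- rewrite L2normZ; last exact: bmf_pair_sum.
  by rewrite ger0_norm ?ler_wpM2l ?exprn_ge0 ?rho_ge0 // L2norm_pair_sum.
Qed.

Lemma span_floor_le : L2dist wstar (agent_span w) <= rho ^+ 2 * a.
Proof.
apply: le_trans (L2dist_le _ total_span) _; exact: L2norm_superposition_total.
Qed.

(** The superposition is total - rho^2 e_2 up to a uniform error of order rho^3.
    As total lies in the span, only rho^2 e_2 contributes to the distance. *)
Lemma span_floor_expansion :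
  `| L2dist wstar (agent_span w) - rho ^+ 2 * L2dist (pair_sum wt) (agent_span w) |
    <= tail_const R J * rho ^+ 3.
Proof.
have [[be bt] bs] := (bmf_pair_sum, bmf_total, bmf_superposition).
have r3 : 0 <= tail_const R J * rho ^+ 3.
  by rewrite mulr_ge0 ?tail_const_ge0 // exprn_ge0 // rho_ge0.
pose g z := (- rho ^+ 2) * pair_sum wt z + total z.
have bg : bounded_mfun g by apply: bmfD => //; exact: bmfZ.
have gd : L2dist g (agent_span w) = rho ^+ 2 * L2dist (pair_sum wt) (agent_span w).
  rewrite span_distZD //; last exact: total_span.
  by rewrite normrN ger0_norm // exprn_ge0 // rho_ge0.
have ng : L2norm (wstar \- g) <= tail_const R J * rho ^+ 3.
  rewrite -(L2norm_cst r3); apply: ler_L2norm.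
  - exact: bmfB.
  - exact: bmf_cst.
  - move=> z qz /=; apply: le_trans (third_order rho_le1 (fun j => w_itv j qz)).
    rewrite pairsM_scale // /g totalE /wstar /superposition.
    by rewrite (_ : _ - (_ + _) = 1 - \prod_(j < J) (1 - w j z)
      - \sum_(j < J) w j z + rho ^+ 2 * pair_sum wt z) //; ring.
have [_ bS _] := span_subspace bw.
have := L2dist_lip (span_nonempty w) bS bs bg.
have := L2dist_lip (span_nonempty w) bS bg bs.
rewrite (L2norm_subC g) gd ler_norml; lra.
Qed.

Lemma min_norm_ge0 : 0 <= b.
Proof. by apply: le_min_agents => j; exact: L2norm_ge0. Qed.

(** A convex combination leaves a total weight J - 1 of the templates unmatched;
    as they are nonnegative, these residues cannot cancel. *)
Lemma lincomb_compl_lower p : simplex p ->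
  (J%:R - 1) / Num.sqrt J%:R * b <= L2norm (lincomb wt (fun j => 1 - p j)).
Proof.
move=> sp; have [p0 p1] := sp.
have p_le1 j : p j <= 1 by rewrite -p1 (bigD1 j) //= lerDl; exact: sumr_ge0.
have J1 : 0 <= J%:R - 1 :> R by rewrite subr_ge0 ler1n.
have c0 : 0 <= (J%:R - 1) / Num.sqrt J%:R * b :> R.
  by rewrite mulr_ge0 ?min_norm_ge0 // divr_ge0 // sqrtr_ge0.
rewrite -(ler_pXn2r (ltn0Sn 1)) ?nnegrE ?L2norm_ge0 //.
rewrite exprMn expr_div_n sqr_sqrtr ?ler0n //.
apply: le_trans (L2norm_sqr_sum_ge _ _ _) => [|j|j z qz]; first last.
- by rewrite mulr_ge0 // ?subr_ge0 //; have /andP[] := wt01 j qz.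
- by apply: bmfZ; exact: bmf_wt.
apply: le_trans (_ : \sum_(j < J) (1 - p j) ^+ 2 * b ^+ 2 <= _).
  by rewrite -mulr_suml ler_wpM2r ?sqr_ge0 // compl_simplex_sqr.
apply: ler_sum => j _; rewrite L2normZ; last exact: bmf_wt.
rewrite exprMn real_normK ?num_real // ler_wpM2l ?sqr_ge0 //.
by rewrite ler_pXn2r ?nnegrE ?L2norm_ge0 ?min_norm_ge0 //; exact: min_agents_le.
Qed.

(** total - sum_j p_j w_j = rho sum_j (1 - p_j) wt_j is of first order, while
    the superposition is within rho^2 a of total. *)
Lemma hull_floor_lower :
  rho * ((J%:R - 1) / Num.sqrt J%:R * b - rho * a) <= L2dist wstar (agent_hull w).
Proof.
apply: le_L2dist => [|_ [p sp <-]].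
  by exists (w (Ordinal hJ)); exact: agent_hull_agent.
have [bt bs] := (bmf_total, bmf_superposition).
have bp : bounded_mfun (lincomb w p) by exact: bmf_lincomb.
have := ler_L2norm_dist bt bs bp; have := L2norm_superposition_total.
rewrite (L2norm_subC total wstar).
have -> : L2norm (total \- lincomb w p) =
          rho * L2norm (lincomb wt (fun j => 1 - p j)).
  rewrite -[X in X * _]ger0_norm ?rho_ge0 // -L2normZ; last first.
    by apply: bmf_lincomb; exact: bmf_wt.
  apply: eq_L2norm => z; rewrite inE => qz.
  rewrite /= /total /lincomb -sumrB mulr_sumr; apply: eq_bigr => j _.
  by rewrite wE //; ring.
have := ler_wpM2l rho_ge0 (lincomb_compl_lower sp).
lra.
Qed.

(** Compare with the vertex of the hull given by the first agent. *)
Lemma hull_floor_upper : L2dist wstar (agent_hull w)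
  <= rho * (\sum_(j < J | (0 < j)%N) L2norm (wt j) + rho * a).
Proof.
have [bt bs] := (bmf_total, bmf_superposition).
pose w0 := w (Ordinal hJ).
apply: le_trans (L2dist_le _ (agent_hull_agent w (Ordinal hJ))) _.
apply: le_trans (ler_L2norm_dist bs bt (bw _)) _.
rewrite addrC mulrDr mulrA -expr2; apply: lerD; last first.
  exact: L2norm_superposition_total.
rewrite (@eq_L2norm _ _ (fun z => rho * \sum_(j < J | (0 < j)%N) wt j z)).
  rewrite L2normZ; last first.
    by apply: bmf_bigop => [|j _]; [exact: bmfD | exact: bmf_wt].
  rewrite ger0_norm ?rho_ge0 // ler_wpM2l ?rho_ge0 //.
  by apply: ler_L2norm_sum => j _; exact: bmf_wt.
move=> z; rewrite inE => qz.
rewrite /= totalE (bigD1 (Ordinal hJ)) //= addrAC subrr add0r mulr_sumr.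
rewrite (eq_bigl (fun j : 'I_J => (0 < j)%N)) => [|j].
  by apply: eq_bigr => j _; rewrite wE.
by rewrite -val_eqE /= lt0n.
Qed.

(** 1 - (1 - x)(1 - y) = x + y - xy: for two agents the expansion stops at second
    order. *)
Lemma span_floor_two (j k : 'I_J) : J = 2%N -> val j = 0%N -> val k = 1%N ->
  L2dist wstar (agent_span w) = rho ^+ 2 * L2dist (wt j \* wt k) (agent_span w).
Proof.
move=> J2 j0 k1.
have sum2 (F : 'I_J -> R) : \sum_(i < J) F i = F j + F k.
  rewrite (bigD1 j) // (bigD1 k) /=; last by rewrite -val_eqE j0 k1.
  rewrite big1 ?addr0 // => i /andP[]; rewrite -!val_eqE j0 k1 /=.
  by case: i => [[|[|i]] iJ] //=; have := iJ; rewrite {1}J2.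
have prod2 (F : 'I_J -> R) : \prod_(i < J) F i = F j * F k.
  rewrite (bigD1 j) // (bigD1 k) /=; last by rewrite -val_eqE j0 k1.
  rewrite big1 ?mulr1 // => i /andP[]; rewrite -!val_eqE j0 k1 /=.
  by case: i => [[|[|i]] iJ] //=; have := iJ; rewrite {1}J2.
have bjk : bounded_mfun (wt j \* wt k) by apply: bmfM; exact: bmf_wt.
have := span_distZD bw (- rho ^+ 2) bjk total_span.
rewrite normrN [`|rho ^+ 2|]ger0_norm ?exprn_ge0 ?rho_ge0 // => <-.
apply: eq_L2dist => z; rewrite inE => qz.
by rewrite /wstar /superposition prod2 totalE sum2 !wE //=; ring.
Qed.

End model.

(** * Small-rho asymptotics *)

Section asymptotics.
Context {R : realType}.

(** With x = N / (rho^2 d), a relative error |x - 1| <= (c / d) rho becomes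
    |x^2 - 1| = |x - 1| |x + 1| for the square. *)
Lemma square_relative_error (N c d rho : R) : 0 < rho <= 1 -> 0 < d -> 0 <= c ->
  `|N - rho ^+ 2 * d| <= c * rho ^+ 3 ->
  `|N ^+ 2 / (rho ^+ 4 * d ^+ 2) - 1| <= c / d * (2 + c / d) * rho.
Proof.
move=> /andP[r0 r1] d0 c0 Nd; pose x := N / (rho ^+ 2 * d).
have [rn dn] : rho != 0 /\ d != 0 by split; exact: lt0r_neq0.
have -> : N ^+ 2 / (rho ^+ 4 * d ^+ 2) - 1 = (x - 1) * (x + 1).
  by rewrite /x; field; rewrite rn dn.
have k0 : 0 <= c / d by rewrite divr_ge0 // ltW.
have x1 : `|x - 1| <= c / d * rho.
  have -> : x - 1 = (N - rho ^+ 2 * d) / (rho ^+ 2 * d).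
    by rewrite /x; field; rewrite rn dn.
  rewrite normrM normfV [`|rho ^+ 2 * d|]ger0_norm; last first.
    by rewrite mulr_ge0 ?exprn_ge0 // ltW.
  rewrite ler_pdivrMr; last by rewrite mulr_gt0 // exprn_gt0.
  by rewrite (_ : _ * (rho ^+ 2 * d) = c * rho ^+ 3) //; field.
have kr : c / d * rho <= c / d by rewrite ler_piMr.
have x2 : `|x + 1| <= 2 + c / d.
  have -> : x + 1 = (x - 1) + 2 by ring.
  by apply: le_trans (ler_normD _ _) _; rewrite (ger0_norm (ler0n _ 2)); lra.
by rewrite normrM mulrAC; apply: ler_pM.
Qed.

Lemma Theta_sqr_right (f : R -> R) (n : nat) (l u e : R) :
  0 < l -> 0 < u -> 0 < e ->
  (forall rho, 0 < rho < e -> l * rho ^+ n <= f rho <= u * rho ^+ n) ->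
  (fun rho => f rho ^+ 2) \is 'Theta_(0^'+) (fun rho : R => rho ^+ (n * 2)).
Proof.
move=> l0 u0 e0 luf; rewrite qualifE; apply/asboolP.
exists (l ^+ 2, u ^+ 2) => /=; first by rewrite !exprn_gt0.
near=> rho.
have rho0 : 0 < rho by near: rho; exact: nbhs_right_gt.
have rhoe : rho < e by near: rho; exact: nbhs_right_lt.
have /andP[lf fu] := luf rho (introT andP (conj rho0 rhoe)).
have l_ge0 : 0 <= l * rho ^+ n by rewrite mulr_ge0 ?exprn_ge0 // ltW.
have f0 := le_trans l_ge0 lf; have u_ge0 := le_trans f0 fu.
rewrite !ger0_norm ?exprn_ge0 ?(ltW rho0) // exprM -!exprMn.
by rewrite !ler_pXn2r ?nnegrE.
Unshelve. all: by end_near. Qed.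

Lemma span_scale J (wt : 'I_J -> plane R -> R) rho : rho != 0 ->
  agent_span (scale_agents rho wt) = agent_span wt.
Proof.
move=> r0; apply/seteqP; split=> [_ [b0 [b ->]]|_ [b0 [b ->]]].
  exists b0, (fun j => b j * rho); apply/funext => z; congr (_ + _).
  by apply: eq_bigr => j _; rewrite /scale_agents mulrA.
exists b0, (fun j => b j / rho); apply/funext => z; congr (_ + _).
by apply: eq_bigr => j _; rewrite /scale_agents mulrA divfK.
Qed.

Lemma pair_sum_span1 J (wt : 'I_J -> plane R -> R) : (J <= 1)%N ->
  L2mem (pair_sum wt) (agent_span wt).
Proof.
move=> J1; exists (pair_sum wt); last exact: ae_eq_refl.
exists 0, (fun=> 0); apply/funext => z; rewrite /affcomb add0r /lincomb.
rewrite [RHS]big1 => [|j _]; last by rewrite mul0r.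
rewrite /pair_sum big1 // => j _; rewrite big1 // => k jk.
by have := leq_trans (leq_ltn_trans (leq0n j) jk) (leq_trans (ltn_ord k) J1).
Qed.

End asymptotics.

Theorem theorem1 (R : realType) (J : nat) (hJ : (0 < J)%N) :
  (* (i) *)
  (forall w : 'I_J -> plane R -> R, agents w ->
   forall wstar : plane R -> R, graphon wstar ->
   let wo := orth_proj (agent_span w) wstar in
   (forall (n : nat) (data : n.-tuple (dyad R)), (0 < n)%N ->
      (forall s, unit_square (tnth data s).1) ->
      (forall p, hull_weights data w p ->
         L2dist wstar (agent_hull w) ^+ 2
           <= L2norm (lincomb w p \- wstar) ^+ 2) /\
      (forall j, selected data w j ->
         min_agents hJ (fun k => L2norm (w k \- wstar) ^+ 2)
           <= L2norm (w j \- wstar) ^+ 2)) /\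
   L2norm (wstar \- wo) ^+ 2 <= L2dist wstar (agent_hull w) ^+ 2 /\
   L2dist wstar (agent_hull w) ^+ 2
     <= min_agents hJ (fun k => L2norm (w k \- wstar) ^+ 2) /\
   (L2dist wstar (agent_hull w) ^+ 2 = L2norm (wstar \- wo) ^+ 2 <->
      L2mem wo (agent_hull w))) /\
  (* (ii) *)
  (forall w wt : 'I_J -> plane R -> R, agents w ->
   forall rho : R, 0 < rho <= 1 ->
   (forall j z, unit_square z -> 0 <= wt j z <= 1) ->
   (forall j z, unit_square z -> w j z = rho * wt j z) ->
   let wstar := superposition w in
   let wo := orth_proj (agent_span w) wstar in
   let a := pair_min_norm wt in
   let b := min_agents hJ (fun j => L2norm (wt j)) in
   `| L2norm (wstar \- wo) - rho ^+ 2 * L2dist (pair_sum wt) (agent_span w) |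
     <= tail_const R J * rho ^+ 3 /\
   L2norm (wstar \- wo) <= rho ^+ 2 * a /\
   rho * Num.max ((J%:R - 1) / Num.sqrt J%:R * b - rho * a) 0
     <= L2dist wstar (agent_hull w) /\
   L2dist wstar (agent_hull w)
     <= rho * (\sum_(j < J | (0 < j)%N) L2norm (wt j) + rho * a)) /\
  (* (iii) *)
  (forall wt : 'I_J -> plane R -> R, agents wt ->
   let w := fun rho : R => scale_agents rho wt in
   let wstar := fun rho : R => superposition (w rho) in
   let H := agent_span wt in
   let floorH := fun rho : R =>
     L2norm (wstar rho \- orth_proj (agent_span (w rho)) (wstar rho)) ^+ 2 in
   let floorC := fun rho : R => L2dist (wstar rho) (agent_hull (w rho)) ^+ 2 in
   let e2 := pair_sum wt in
   let a := pair_min_norm wt in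
   let b := min_agents hJ (fun j => L2norm (wt j)) in
   (~ L2mem e2 H ->
      exists2 err : R -> R, err =O_ (0^'+) (fun rho : R => rho) &
        \forall rho \near (0 : R)^'+,
          floorH rho = rho ^+ 4 * L2dist e2 H ^+ 2 * (1 + err rho)) /\
   (J = 2%N -> forall j k : 'I_J, val j = 0%N -> val k = 1%N ->
      forall rho : R, 0 < rho <= 1 ->
        floorH rho = rho ^+ 4 * L2dist (wt j \* wt k) H ^+ 2) /\
   (0 < b -> forall rho : R, 0 < rho <= 1 ->
      rho <= (J%:R - 1) * b / (2 * Num.sqrt J%:R * a) ->
      rho ^+ 2 * (J%:R - 1) ^+ 2 * b ^+ 2 / (4 * J%:R) <= floorC rho) /\
   (~ L2mem e2 H -> 0 < b ->
      floorH \is 'Theta_(0^'+) (fun rho : R => rho ^+ 4) /\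
      floorC \is 'Theta_(0^'+) (fun rho : R => rho ^+ 2))).
Proof.
split; [|split].
- move=> w [gw _] wstar gs wo.
  have bw j : bounded_mfun (w j) by exact: graphon_bmf.
  have bs := graphon_bmf gs.
  have hull0 : agent_hull w !=set0.
    by exists (w (Ordinal hJ)); exact: agent_hull_agent.
  have d0 : 0 <= L2dist wstar (agent_hull w) by exact: L2dist_ge0.
  have dle h : agent_hull w h ->
      L2dist wstar (agent_hull w) ^+ 2 <= L2norm (h \- wstar) ^+ 2.
    move=> Hh; rewrite L2norm_subC ler_pXn2r ?nnegrE ?L2norm_ge0 //.
    exact: L2dist_le.
  split; [|split; [|split]].
  + move=> n data _ _; split=> [p [sp _]|j _]; first by apply: dle; exists p.
    exact: (min_agents_le hJ (fun k => L2norm (w k \- wstar) ^+ 2)).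
  + rewrite ler_pXn2r ?nnegrE ?L2norm_ge0 // L2norm_sub_orth_proj //.
    exact: L2dist_hull_ge_proj.
  + by apply: le_min_agents => j; apply: dle; exact: agent_hull_agent.
  + exact: hull_floor_eqP.
- move=> w wt [gw _] rho r01 wt01 wE wstar wo a b.
  have bw j : bounded_mfun (w j) by exact: graphon_bmf.
  have bs := bmf_superposition bw.
  rewrite L2norm_sub_orth_proj //.
  split; [|split; [|split]].
  + exact: span_floor_expansion.
  + exact: span_floor_le.
  + rewrite maxr_pMr; last exact: (rho_ge0 r01).
    rewrite mulr0 ge_max; apply/andP; split; first exact: (hull_floor_lower hJ bw r01).
    by apply: L2dist_ge0; exists (w (Ordinal hJ)); exact: agent_hull_agent.
  + exact: hull_floor_upper.
- move=> wt [gwt _] w wstar H floorH floorC e2 a b.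
  have bwt j : bounded_mfun (wt j) by exact: graphon_bmf.
  have bw rho j : bounded_mfun (w rho j) by exact: bmfZ.
  have wt01 j z : unit_square z -> 0 <= wt j z <= 1.
    by move=> qz; have [_ _] := gwt j; exact.
  have wE rho j z : unit_square z -> w rho j z = rho * wt j z by [].
  have Hw rho : 0 < rho -> agent_span (w rho) = H.
    by move=> r0; rewrite /w span_scale // lt0r_neq0.
  have floorHE rho : 0 < rho -> floorH rho = L2dist (wstar rho) H ^+ 2.
    move=> r0; rewrite /floorH L2norm_sub_orth_proj ?Hw //.
    exact: bmf_superposition.
  have be2 : bounded_mfun e2.
    by apply: (bmf_pair_sum (bw 1) _ (wE 1)); rewrite ltr01 lexx.
  have d_gt0 : ~ L2mem e2 H -> 0 < L2dist e2 H.
    move=> e2H; rewrite lt_def L2dist_ge0 ?andbT; last exact: span_nonempty.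
    by apply/eqP => /(span_dist0 bwt be2).
  have Hexp rho : 0 < rho <= 1 ->
      `|L2dist (wstar rho) H - rho ^+ 2 * L2dist e2 H| <= tail_const R J * rho ^+ 3.
    move=> r01; have r0 := rho_gt0 r01; rewrite -(Hw rho) //.
    exact: span_floor_expansion.
  have Hle rho : 0 < rho <= 1 -> L2dist (wstar rho) H <= rho ^+ 2 * a.
    move=> r01; have r0 := rho_gt0 r01; rewrite -(Hw rho) //.
    exact: span_floor_le.
  have Clow rho : 0 < rho <= 1 ->
      rho * ((J%:R - 1) / Num.sqrt J%:R * b - rho * a)
        <= L2dist (wstar rho) (agent_hull (w rho)).
    by move=> r01; exact: (hull_floor_lower hJ (bw rho) r01).
  have Cup rho : 0 < rho <= 1 -> L2dist (wstar rho) (agent_hull (w rho))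
      <= rho * (\sum_(j < J | (0 < j)%N) L2norm (wt j) + rho * a).
    by move=> r01; exact: hull_floor_upper.
  have a0 : 0 <= a.
    apply: sumr_ge0 => j _; apply: sumr_ge0 => k _.
    by rewrite le_min !L2norm_ge0.
  have c0 := tail_const_ge0 (R := R) J.
  have J0 : 0 < J%:R :> R by rewrite ltr0n.
  have sJ0 : 0 < Num.sqrt J%:R :> R by rewrite sqrtr_gt0.
  split; [|split; [|split]].
  + move=> /d_gt0 d0.
    exists (fun rho => floorH rho / (rho ^+ 4 * L2dist e2 H ^+ 2) - 1).
      apply/eqO_exP.
      pose k := tail_const R J / L2dist e2 H * (2 + tail_const R J / L2dist e2 H).
      have k0 : 0 <= k.
        by rewrite mulr_ge0 ?addr_ge0 // divr_ge0 // ltW.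
      exists (k + 1); first by rewrite ltr_wpDl.
      near=> rho.
      have r0 : 0 < rho by near: rho; exact: nbhs_right_gt.
      have r1 : rho <= 1 by near: rho; exact: nbhs_right_le.
      have r01 : 0 < rho <= 1 by rewrite r0.
      rewrite floorHE // (ger0_norm (ltW r0)).
      apply: le_trans (square_relative_error r01 d0 c0 (Hexp rho r01)) _.
      by rewrite -/k ler_wpM2r ?lerDl // ltW.
    near=> rho.
    have r0 : 0 < rho by near: rho; exact: nbhs_right_gt.
    by rewrite addrC subrK mulrC divfK // mulf_neq0 // expf_neq0 // lt0r_neq0.
  + move=> J2 j k j0 k1 rho r01; have r0 := rho_gt0 r01.
    rewrite floorHE // -(Hw rho) //.
    rewrite (span_floor_two (bw rho) r01 (wE rho) J2 j0 k1).
    by rewrite exprMn -exprM.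
  + move=> b0 rho r01 rhole; have r0 := rho_gt0 r01.
    have a_gt0 : 0 < a.
      rewrite lt_def a0 andbT; apply/eqP => a00; move: rhole.
      by rewrite a00 mulr0 invr0 mulr0 leNgt r0.
    have J1 : 0 <= J%:R - 1 :> R by rewrite subr_ge0 ler1n.
    pose m := (J%:R - 1) / Num.sqrt J%:R * b.
    have m0 : 0 <= m by rewrite mulr_ge0 ?(ltW b0) // divr_ge0 // ltW.
    have ram : rho * a <= m / 2.
      move: rhole; rewrite ler_pdivlMr; last by rewrite !mulr_gt0.
      move=> h; rewrite -(ler_pM2r (_ : 0 < 2 * Num.sqrt J%:R)) ?mulr_gt0 //.
      rewrite (_ : m / 2 * _ = (J%:R - 1) * b); first by apply: le_trans h; lra.
      by rewrite /m; field; exact: lt0r_neq0.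
    have low : rho * (m / 2) <= L2dist (wstar rho) (agent_hull (w rho)).
      apply: le_trans (Clow rho r01); rewrite ler_wpM2l ?(ltW r0) //.
      by rewrite -/m; lra.
    have l0 : 0 <= rho * (m / 2) by rewrite mulr_ge0 ?divr_ge0 // ltW.
    rewrite (_ : _ / _ = (rho * (m / 2)) ^+ 2).
      by rewrite ler_pXn2r ?nnegrE // (le_trans l0).
    rewrite /m !exprMn exprVn sqr_sqrtr ?ler0n //.
    by field; exact: lt0r_neq0.
  + move=> e2H b0; have d0 := d_gt0 e2H; split.
    * (* the cubic error is absorbed by half of the main term *)
      pose d := L2dist e2 H; pose c := tail_const R J.
      pose e := Num.min 1 (d / (2 * (c + 1))).
      have c1 : 0 < 2 * (c + 1) by rewrite mulr_gt0 // ltr_wpDl.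
      have e0 : 0 < e by rewrite lt_min ltr01 divr_gt0.
      apply: (@Theta_sqr_right _ _ 2 (d / 2) (a + 1) e) => //.
      + by rewrite divr_gt0.
      + by rewrite ltr_wpDl.
      move=> rho /andP[r0]; rewrite lt_min => /andP[r1].
      rewrite ltr_pdivlMr // => rd; have r01 : 0 < rho <= 1 by rewrite r0 ltW.
      rewrite L2norm_sub_orth_proj ?Hw //; last exact: bmf_superposition.
      have rr := exprn_ge0 2 (ltW r0).
      have := Hle rho r01; have := Hexp rho r01; rewrite ler_norml -/d -/c.
      have : 0 <= rho ^+ 2 * (d / 2 - c * rho) by rewrite mulr_ge0 //; lra.
      by move=> ? /andP[? ?] ?; apply/andP; split; lra.
    * (* a floor of order rho needs J > 1, which e2 \notin H provides *)
      have J1 : 0 < J%:R - 1 :> R.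
        by rewrite subr_gt0 ltr1n ltnNge; apply/negP => /pair_sum_span1 - /(_ _ wt).
      pose m := (J%:R - 1) / Num.sqrt J%:R * b.
      have m0 : 0 < m by rewrite mulr_gt0 // divr_gt0.
      pose s := \sum_(j < J | (0 < j)%N) L2norm (wt j).
      have s0 : 0 <= s by apply: sumr_ge0 => j _; exact: L2norm_ge0.
      pose e := Num.min 1 (m / (2 * (a + 1))).
      have a1 : 0 < 2 * (a + 1) by rewrite mulr_gt0 // ltr_wpDl.
      have e0 : 0 < e by rewrite lt_min ltr01 divr_gt0.
      apply: (@Theta_sqr_right _ _ 1 (m / 2) (s + a + 1) e) => //.
      + by rewrite divr_gt0.
      + by rewrite ltr_wpDl // addr_ge0.
      move=> rho /andP[r0]; rewrite lt_min => /andP[r1].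
      rewrite ltr_pdivlMr // => rm; have r01 : 0 < rho <= 1 by rewrite r0 ltW.
      have := Clow rho r01; have := Cup rho r01; rewrite -/m -/s expr1.
      have : 0 <= rho * (m / 2 - rho * a) by rewrite mulr_ge0 ?(ltW r0) //; lra.
      have : 0 <= rho * ((1 - rho) * a).
        by rewrite !mulr_ge0 ?subr_ge0 // ltW.
      by move=> *; apply/andP; split; lra.
Unshelve. all: by end_near. Qed.
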